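(* There exists a graph $H'$ on the vertex set $\mathbb{Z}^2$ such that for any two integer points $p$ and $q$, $$d_{H'}(p,q)=d(p,q)+O\left(\frac{d(p,q)}{\log^{2/3}(d(p,q))}\right)$$ as $d(p,q)$ tends to infinity; that is, there are constants $K$ and $D>1$ such that $|d_{H'}(p,q)-d(p,q)|\le K\frac{d(p,q)}{(\log d(p,q))^{2/3}}$ for all $p,q\in\mathbb{Z}^2$ with $d(p,q)\ge D$.
   Context: $d(p,q)$ is the Euclidean distance. Graphs are simple and unweighted; $d_{H'}(p,q)$ is the graph distance, i.e. the minimum number of edges along a path connecting $p$ and $q$ in $H'$. *)

(* Defs.v *)
From mathcomp Require Import all_boot all_order all_algebra.
From mathcomp Require Import reals exp.

Set Implicit Arguments.
Unset Strict Implicit.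
Unset Printing Implicit Defensive.

Import Order.TTheory GRing.Theory Num.Theory.

Local Open Scope ring_scope.

Record simple_graph (V : eqType) := SimpleGraph {
  adj :> rel V;
  adj_sym : symmetric adj;
  adj_irrefl : irreflexive adj }.

(* The vertices of the path are p :: s, so its number of edges is size s. *)
Definition graph_path (V : eqType) (H : simple_graph V) (p q : V) (s : seq V)
    : Prop :=
  [/\ path H p s, uniq (p :: s) & last p s = q].

(* A relation rather than a function: it holds of no n when p and q are not
   connected, so that asserting it includes finiteness of the distance. *)
Definition is_graph_dist (V : eqType) (H : simple_graph V) (p q : V) (n : nat)
    : Prop :=
  (exists2 s : seq V, graph_path H p q s & size s = n) /\
  (forall s : seq V, graph_path H p q s -> (n <= size s)%N).

Definition euclid_dist (R : realType) (p q : int * int) : R :=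
  Num.sqrt ((p.1 - q.1)%:~R ^+ 2 + (p.2 - q.2)%:~R ^+ 2).

(* Main.v *)
Require Import Defs.
From mathcomp Require Import all_boot all_order all_algebra.
From mathcomp Require Import reals exp.
From mathcomp Require Import boolp archimedean zify ring lra.
From Stdlib Require PeanoNat.

Set Implicit Arguments.
Unset Strict Implicit.
Unset Printing Implicit Defensive.

Import Order.TTheory GRing.Theory Num.Theory.

Local Open Scope ring_scope.

(* Place the vertices at points [vertex_pos v] of the plane at bounded distance from [v], and join
   two vertices when their positions are at distance at most 1: graph distances are then at
   least Euclidean distances minus a constant. For the upper bound the positions must contain
   long "highways", straight chains of unit steps, in more and more directions at larger and
   larger scales, while only boundedly many positions are available in a bounded region.
   Windows of scale t are squares of side [side t], where [side t.+1 = (t + 8) * side t], and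
   each scale t has one direction and a family of parallel lines of that direction at spacing
   about [side t]. A window of scale t is allowed to contain at most one line of scale > t, its
   foreign line: if the foreign line of the enclosing window meets it, that one, and
   otherwise the line of scale t+1 meeting it, if any. So every 8 x 8 cell hosts a single
   line. Travelling along a line of scale t+1 through a window of scale t+1, one is obstructed
   only by the foreign line of that window, and following this foreign line instead costs
   O(side t), a fraction O(1/t). The directions of the scales below n contain all the slopes
   a/m with |a| <= m, where m is of order sqrt n, and decomposing a vector along two
   neighbouring slopes costs a factor 1 + O(1/m^2) = 1 + O(1/n). For side n <= d < side n.+1,
   log d is about n log n, hence at most of order n^(3/2). *)

(** * Euclidean distance in the real plane *)

Section Plane.
Variable R : realType.
Implicit Types P Q A : R * R.

Definition dst P Q : R := Num.sqrt ((P.1 - Q.1) ^+ 2 + (P.2 - Q.2) ^+ 2).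

Lemma dst_ge0 P Q : 0 <= dst P Q.
Proof. exact: sqrtr_ge0. Qed.

Lemma dst_sqr P Q : dst P Q ^+ 2 = (P.1 - Q.1) ^+ 2 + (P.2 - Q.2) ^+ 2.
Proof. by rewrite sqr_sqrtr // addr_ge0 // sqr_ge0. Qed.

Lemma dst_sym P Q : dst P Q = dst Q P.
Proof. by congr (Num.sqrt _); ring. Qed.

Lemma dst_le P Q x : 0 <= x ->
  (dst P Q <= x) = ((P.1 - Q.1) ^+ 2 + (P.2 - Q.2) ^+ 2 <= x ^+ 2).
Proof. by move=> x0; rewrite -dst_sqr ler_pXn2r ?nnegrE ?dst_ge0. Qed.

Lemma dst_triangle Q P A : dst P A <= dst P Q + dst Q A.
Proof.
rewrite dst_le ?addr_ge0 ?dst_ge0 // [leRHS]sqrrD.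
rewrite (dst_sqr P Q) (dst_sqr Q A).
set u := dst P Q; set v := dst Q A.
have u2 : u ^+ 2 = (P.1 - Q.1) ^+ 2 + (P.2 - Q.2) ^+ 2 := dst_sqr _ _.
have v2 : v ^+ 2 = (Q.1 - A.1) ^+ 2 + (Q.2 - A.2) ^+ 2 := dst_sqr _ _.
have u0 : 0 <= u := dst_ge0 _ _.
have v0 : 0 <= v := dst_ge0 _ _.
suff h : (P.1 - Q.1) * (Q.1 - A.1) + (P.2 - Q.2) * (Q.2 - A.2) <= u * v.
  rewrite mulr2n; nra.
apply: le_trans (ler_norm _) _.
rewrite -(ler_pXn2r (isT : (0 < 2)%N)) ?nnegrE ?mulr_ge0 //.
rewrite real_normK ?num_real // exprMn u2 v2.
have := sqr_ge0 ((P.1 - Q.1) * (Q.2 - A.2) - (P.2 - Q.2) * (Q.1 - A.1)); nra.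
Qed.

Lemma dst_ge_abs P Q : (`|P.1 - Q.1| <= dst P Q) /\ (`|P.2 - Q.2| <= dst P Q).
Proof.
have h (x y : R) : `|x| <= Num.sqrt (x ^+ 2 + y ^+ 2).
  by rewrite -sqrtr_sqr ler_sqrt ?addr_ge0 ?sqr_ge0 // lerDl sqr_ge0.
by split; [exact: h|rewrite /dst [X in Num.sqrt X]addrC; exact: h].
Qed.

Lemma dst_le_l1 P Q : dst P Q <= `|P.1 - Q.1| + `|P.2 - Q.2|.
Proof.
rewrite dst_le ?addr_ge0 // [leRHS]sqrrD !real_normK ?num_real // mulr2n.
have : 0 <= `|P.1 - Q.1| * `|P.2 - Q.2| by rewrite mulr_ge0.
lra.
Qed.

Definition swap_if (T : Type) (b : bool) (P : T * T) := if b then (P.2, P.1) else P.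

Lemma swap_ifK (T : Type) b (P : T * T) : swap_if b (swap_if b P) = P.
Proof. by case: b P => -[]. Qed.

Lemma dst_swap b P Q : dst (swap_if b P) (swap_if b Q) = dst P Q.
Proof. by case: b => //; congr (Num.sqrt _) => /=; ring. Qed.

End Plane.

(** * Nested square windows *)

Section Windows.
Variable R : realType.
Implicit Types P Q : R * R.

Fixpoint side (t : nat) : nat := if t is t'.+1 then ((t' + 8) * side t')%N else 8%N.

Lemma sideS t : (side t.+1 = (t + 8) * side t)%N. Proof. by []. Qed.

Lemma side_gt (t : nat) : (t + 7 < side t)%N.
Proof. by elim: t => [//|t IH]; rewrite sideS; nia. Qed.

Lemma side_ge8 t : 8 <= (side t)%:R :> R.
Proof. by rewrite (ler_nat R 8); have := side_gt t; lia. Qed.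

Lemma side_gt0 t : 0 < (side t)%:R :> R. Proof. by have := side_ge8 t; lra. Qed.

Lemma sideSr t : (side t.+1)%:R = (t%:R + 8) * (side t)%:R :> R.
Proof. by rewrite sideS natrM natrD. Qed.

Lemma sideS_ge8 t : 8 * (side t)%:R <= (side t.+1)%:R :> R.
Proof. by rewrite sideSr ler_pM2r ?side_gt0 // lerDr ler0n. Qed.

Definition window (t : nat) P : int * int :=
  (Num.floor (P.1 / (side t)%:R), Num.floor (P.2 / (side t)%:R)).

Lemma floor_near (l x y : R) : 0 < l ->
  Num.floor (x / l) = Num.floor (y / l) -> `|x - y| < l.
Proof.
move=> l0 e.
have /andP[] := floor_itv (x / l); have /andP[] := floor_itv (y / l).
rewrite e; move: (Num.floor _) => n; rewrite intrD.
rewrite !ler_pdivlMr // !ltr_pdivrMr //.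
by rewrite ltr_norml => *; apply/andP; split; lra.
Qed.

Lemma window_near t P Q : window t P = window t Q ->
  `|P.1 - Q.1| < (side t)%:R /\ `|P.2 - Q.2| < (side t)%:R.
Proof.
by case=> /floor_near h1 /floor_near h2; split; [apply: h1|apply: h2]; exact: side_gt0.
Qed.

(** Every multiple of [k * l] is a multiple of [l], so a fine window never straddles the boundary of
    a coarser one. *)
Lemma floor_coarsen (k : nat) (l x y : R) : (0 < k)%N -> 0 < l ->
  Num.floor (x / l) = Num.floor (y / l) ->
  Num.floor (x / (k%:R * l)) = Num.floor (y / (k%:R * l)).
Proof.
move=> k0 l0 e.
have kr : 0 < k%:R :> R by rewrite ltr0n.
have kl0 : 0 < k%:R * l by rewrite mulr_gt0.
apply/esym/floor_def.
have /andP[] := floor_itv (x / (k%:R * l)).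
set n := Num.floor (x / (k%:R * l)).
rewrite ler_pdivlMr // ltr_pdivrMr // !mulrA.
rewrite -(ler_pdivlMr _ _ l0) -(ltr_pdivrMr _ _ l0).
have -> : n%:~R * k%:R = (n * k%:Z)%:~R :> R by rewrite intrM.
have -> : (n + 1)%:~R * k%:R = ((n + 1) * k%:Z)%:~R :> R by rewrite intrM.
rewrite -floor_ge_int -floor_lt_int e floor_ge_int floor_lt_int !intrM.
rewrite ler_pdivlMr // ltr_pdivrMr // -!mulrA => h1 h2.
by rewrite ler_pdivlMr // ltr_pdivrMr // h1 h2.
Qed.

Lemma window_succ t P Q : window t P = window t Q -> window t.+1 P = window t.+1 Q.
Proof.
case=> e1 e2; rewrite /window sideS natrM.
by congr pair; apply: floor_coarsen; rewrite ?side_gt0 // addn_gt0 orbT.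
Qed.

Lemma window_swap t b P : window t (swap_if b P) = swap_if b (window t P).
Proof. by case: b. Qed.

Lemma floor_between (l x a y : R) : 0 < l -> (x <= a <= y) || (y <= a <= x) ->
  Num.floor (x / l) = Num.floor (y / l) ->
  Num.floor (a / l) = Num.floor (x / l).
Proof.
move=> l0 h e; apply/eqP; rewrite eq_le.
case/orP: h => /andP[h1 h2]; [rewrite {1}e|rewrite {2}e];
  by apply/andP; split; apply: le_floor; rewrite ler_pM2r ?invr_gt0.
Qed.

End Windows.

(** * Directions and families of parallel lines *)

Section Lines.
Variable R : realType.

(* For [t./2 = m^2 + m + a] with [`|a| <= m] the slope is [a / m]. *)
Definition slope (t : nat) : R :=
  let m := PeanoNat.Nat.sqrt t./2 in
  ((t./2)%:R - (m ^ 2 + m)%:R) / m%:R.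

(** As [a] runs over [[-m, m]], [m^2 + m + a] runs over the integers whose square root rounds down
    to [m]. So [t./2] encodes the fraction, and the parity of [t] stays free to select the main
    axis. *)
Lemma slope_code (m : nat) (a : int) (b : bool) : (0 < m)%N -> `|a| <= m%:Z ->
  exists2 t : nat, [/\ odd t = b, slope t = a%:~R / m%:R & (0 < t)%N] &
    (2 * m ^ 2 <= t <= 2 * m ^ 2 + 4 * m + 1)%N.
Proof.
move=> m0 ham; pose q := absz ((m ^ 2 + m)%:Z + a).
have hq : q%:Z = (m ^ 2 + m)%:Z + a by rewrite /q; lia.
have [q1 q2] : (m * m <= q)%N /\ (q <= m * m + 2 * m)%N.
  by move: ham hq; rewrite -mulnn; set mm := (m * m)%N; lia.
have mm0 : (0 < m * m)%N by rewrite muln_gt0 m0.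
exists (b + q.*2)%N; last first.
  by rewrite -mulnn; move: q1 q2; set mm := (m * m)%N; case: (b); lia.
have half : (b + q.*2)./2 = q by rewrite halfD odd_double andbF doubleK; case: (b).
split.
- by rewrite oddD odd_double addbF; case: (b).
- rewrite /slope half; have -> : PeanoNat.Nat.sqrt q = m.
    apply: PeanoNat.Nat.sqrt_unique; split; first exact: (elimT ssrnat.leP q1).
    apply: (elimT ssrnat.ltP); rewrite multE mulSn mulnS.
    by move: q2; set mm := (m * m)%N; lia.
  have := congr1 (fun z : int => z%:~R : R) hq.
  rewrite intrD -(pmulrn 1 q) -(pmulrn 1 (m ^ 2 + m)) => ->.
  by rewrite [_ + a%:~R]addrC addrK.
- by move: q1 mm0; set mm := (m * m)%N; lia.
Qed.

Lemma slope_le1 t : `|slope t| <= 1.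
Proof.
rewrite /slope; set q := t./2; set m := PeanoNat.Nat.sqrt q.
have [h1 h2] : ((m * m)%coq_nat <= q)%coq_nat /\ (q < (m.+1 * m.+1)%coq_nat)%coq_nat
  by exact: PeanoNat.Nat.sqrt_specif.
have [->|m0] := posnP m; first by rewrite invr0 mulr0 normr0.
have mr : 0 < m%:R :> R by rewrite ltr0n.
rewrite normrM normfV (gtr0_norm mr) ler_pdivrMr // mul1r.
have {}h1 : (m * m <= q)%N by apply/ssrnat.leP.
have {}h2 : (q < m * m + m + m + 1)%N.
  by move/ssrnat.ltP: h2; rewrite multE mulSn mulnS; set mm := (m * m)%N; lia.
have h3 : (m ^ 2 + m)%:R <= q%:R + m%:R :> R by rewrite -natrD ler_nat -mulnn; lia.
have h4 : q%:R <= (m ^ 2 + m)%:R + m%:R :> R by rewrite -natrD ler_nat -mulnn; lia.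
by rewrite ler_norml; apply/andP; split; lra.
Qed.

Definition cosine t : R := (Num.sqrt (1 + slope t ^+ 2))^-1.

Lemma cosine_gt0 t : 0 < cosine t.
Proof. by rewrite invr_gt0 sqrtr_gt0; have := sqr_ge0 (slope t); lra. Qed.

Lemma cosine_sqr t : cosine t ^+ 2 * (1 + slope t ^+ 2) = 1.
Proof.
have h : 0 < 1 + slope t ^+ 2 by have := sqr_ge0 (slope t); lra.
by rewrite /cosine exprVn sqr_sqrtr ?ltW // mulVf ?gt_eqF.
Qed.

Lemma slope_sqr_le1 t : slope t ^+ 2 <= 1.
Proof. by rewrite -(real_normK (num_real _)) expr_le1 ?slope_le1. Qed.

Lemma cosine_le1 t : cosine t <= 1.
Proof.
rewrite -(@expr_le1 _ 2) // ?(ltW (cosine_gt0 t)) //.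
have := cosine_sqr t.
by have := mulr_ge0 (sqr_ge0 (cosine t)) (sqr_ge0 (slope t)); lra.
Qed.

Lemma cosine_ge t : 2 / 3 <= cosine t.
Proof.
rewrite -(@ler_pXn2r _ 2) ?nnegrE ?(ltW (cosine_gt0 t)) //; last lra.
have := cosine_sqr t; have := ler_wpM2l (sqr_ge0 (cosine t)) (slope_sqr_le1 t); lra.
Qed.

(** The scale, which fixes slope and main axis, and the index within the parallel family. *)
Definition line := (nat * int)%type.

(** The factor [cosine] makes consecutive points unit-spaced. The offset [2^-1] keeps all intercepts
    away from 0, so that no line of large scale passes near the origin. *)
Definition axis_pt (l : line) (j : int) : R * R :=
  (j%:~R * cosine l.1,
   slope l.1 * (j%:~R * cosine l.1) + (l.2%:~R + 2^-1) * (side l.1)%:R).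

Definition line_pt (l : line) (j : int) : R * R := swap_if (odd l.1) (axis_pt l j).

Lemma dst_line_pt l i j : dst (line_pt l i) (line_pt l j) = `|i - j|%:~R.
Proof.
rewrite dst_swap /dst /=.
set k := cosine _; set s := slope _.
have -> : (i%:~R * k - j%:~R * k) ^+ 2 +
  (s * (i%:~R * k) + (l.2%:~R + 2^-1) * (side l.1)%:R -
   (s * (j%:~R * k) + (l.2%:~R + 2^-1) * (side l.1)%:R)) ^+ 2 =
  (i%:~R - j%:~R) ^+ 2 * (k ^+ 2 * (1 + s ^+ 2)) by ring.
by rewrite cosine_sqr mulr1 sqrtr_sqr -intrB intr_norm.
Qed.

Lemma window_line_pt t l i j :
  (window t (line_pt l i) = window t (line_pt l j)) <->
  (window t (axis_pt l i) = window t (axis_pt l j)).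
Proof. by rewrite !window_swap; split=> [/(can_inj (@swap_ifK _ _))|->]. Qed.

(** Both coordinates are monotone in the index, and a floor that agrees at two points is constant
    between them. *)
Lemma line_pt_convex t l (i k j : int) : i <= k <= j ->
  window t (line_pt l i) = window t (line_pt l j) ->
  window t (line_pt l k) = window t (line_pt l i).
Proof.
move=> /andP[ik kj] /window_line_pt [e1 e2]; apply/window_line_pt.
have k0 := cosine_gt0 l.1.
have h1 : i%:~R * cosine l.1 <= k%:~R * cosine l.1 by rewrite ler_pM2r // ler_int.
have h2 : k%:~R * cosine l.1 <= j%:~R * cosine l.1 by rewrite ler_pM2r // ler_int.
congr pair; [apply: floor_between e1|apply: floor_between e2]; rewrite ?side_gt0 //=.
  by rewrite h1 h2.
rewrite !lerD2r; case: (lerP 0 (slope l.1)) => s0.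
  by apply/orP; left; apply/andP; split; apply: ler_wpM2l.
by apply/orP; right; apply/andP; split; apply: ler_wnM2l; rewrite // ltW.
Qed.

(** Points sharing a window of scale [t] have intercepts less than [2 * side t] apart, while
    distinct parallel lines have intercepts at least [side t.+1 >= 8 * side t] apart. *)
Lemma line_pt_uniq t (c c' j j' : int) :
  window t (line_pt (t.+1, c) j) = window t (line_pt (t.+1, c') j') -> c = c'.
Proof.
rewrite /line_pt /= !window_swap => /(can_inj (@swap_ifK _ _)) /window_near /= [].
have := slope_le1 t.+1; set s := slope _; set x := _ * cosine _; set y := _ * cosine _.
have := sideS_ge8 R t; have := side_gt0 R t; set l := (side t)%:R; set l' := (side t.+1)%:R.
move=> l0 ll' hs hx hy.
have hxy : `|s * (x - y)| <= l.
  by rewrite normrM -[l]mul1r ler_pM // ltW.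
have e : (c - c')%:~R * l' =
   (s * x + (c%:~R + 2^-1) * l' - (s * y + (c'%:~R + 2^-1) * l')) - s * (x - y).
  by rewrite intrB; ring.
have h : `|(c - c')%:~R * l'| < l'.
  by rewrite e; apply: le_lt_trans (ler_normB _ _) _; lra.
move: h; rewrite normrM (@gtr0_norm _ l') ?gtr_pMl; try lra.
by rewrite -intr_norm ltrz1; lia.
Qed.

(** A point sharing the window of [P] has intercept below [4 * side t] in absolute value, but the
    half-integer offset forces at least [side t.+1 / 2]. *)
Lemma line_pt_far t (c j : int) (P : R * R) :
  `|P.1| < (side t)%:R -> `|P.2| < (side t)%:R -> window t (line_pt (t.+1, c) j) <> window t P.
Proof.
move=> h1 h2; rewrite -[P](swap_ifK (odd t.+1)).
have {h1 h2} : `|(swap_if (odd t.+1) P).1| < (side t)%:R /\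
  `|(swap_if (odd t.+1) P).2| < (side t)%:R by case: (odd _).
move: (swap_if _ P) => {}P [h1 h2]; rewrite !window_swap => /(can_inj (@swap_ifK _ _)).
move=> /window_near /= [].
have := slope_le1 t.+1; set s := slope _; set x := _ * cosine _.
have := sideS_ge8 R t; have := side_gt0 R t; move: h1 h2.
set l := (side t)%:R; set l' := (side t.+1)%:R => h1 h2 l0 ll' hs hx hy.
have hx' : `|s * x| <= 2 * l.
  rewrite normrM -[2 * l]mul1r ler_pM //.
  by have := ler_normD (x - P.1) P.1; rewrite subrK; lra.
have hc : 2^-1 <= `|c%:~R + 2^-1 : R|.
  case: (lerP 0 c) => c0.
    have : 0 <= c%:~R :> R by rewrite ler0z.
    by move=> h; rewrite ger0_norm; lra.
  have : c%:~R <= (-1)%:~R :> R by rewrite ler_int; lia.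
  by rewrite mulrN1z => h; rewrite ler0_norm; lra.
have e : (c%:~R + 2^-1) * l' =
   (s * x + (c%:~R + 2^-1) * l' - P.2) + P.2 - s * x by ring.
have : `|(c%:~R + 2^-1) * l'| < 4 * l.
  rewrite e; apply: le_lt_trans (ler_normB _ _) _.
  by have := ler_normD (s * x + (c%:~R + 2^-1) * l' - P.2) P.2; lra.
rewrite normrM (@gtr0_norm _ l'); last lra.
have := ler_wpM2r (_ : 0 <= l') hc; lra.
Qed.

End Lines.

(** * Assignment of lines to windows *)

Section Foreign.
Variable R : realType.
Implicit Types (P Q : R * R) (l : line).

Definition hits l t (w : int * int) := exists j, window t (line_pt R l j) = w.

(** The choice is immaterial: by [line_pt_uniq] at most one index [c] qualifies. *)
Definition own_line t w : option line :=
  if pselect (exists c, hits (t.+1, c) t w) is left e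
  then Some (t.+1, sval (cid e)) else None.

Lemma own_line_pt t c j : own_line t (window t (line_pt R (t.+1, c) j)) = Some (t.+1, c).
Proof.
rewrite /own_line; case: pselect => [e|[]]; last by exists c, j.
by case: (cid e) => c' [j'] /= /line_pt_uniq ->.
Qed.

Definition inherit (f : option line) t w : option line :=
  if f is Some l then (if `[< hits l t w >] then Some l else own_line t w)
  else own_line t w.

(** Lines are inherited from coarser windows, a recursion with no top scale. The fuel [k] starts it
    without a line at scale [t + k]; by [foreign_uptoE] the result no longer changes once [t + k]
    reaches [far_scale P]. *)
Fixpoint foreign_upto k t P : option line :=
  if k is k'.+1 then inherit (foreign_upto k' t.+1 P) t (window t P) else None.

Definition far_scale P : nat := (Num.truncn (`|P.1| + `|P.2|)).+1.

Definition foreign t P := foreign_upto (far_scale P) t P.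

Lemma own_line_far t P : (far_scale P <= t)%N -> own_line t (window t P) = None.
Proof.
move=> Pt; rewrite /own_line; case: pselect => // -[c [j]] /line_pt_far [].
  apply: le_lt_trans (_ : `|P.1| + `|P.2| < _); rewrite ?lerDl //.
  by apply: lt_trans (truncnS_gt _) _; rewrite ltr_nat (leq_ltn_trans Pt) //;
    have := side_gt t; lia.
apply: le_lt_trans (_ : `|P.1| + `|P.2| < _); rewrite ?lerDr //.
by apply: lt_trans (truncnS_gt _) _; rewrite ltr_nat (leq_ltn_trans Pt) //;
    have := side_gt t; lia.
Qed.

Lemma foreign_upto_far k t P : (far_scale P <= t)%N -> foreign_upto k t P = None.
Proof.
elim: k t => //= k IH t Pt.
by rewrite IH ?(leqW Pt) //= own_line_far.
Qed.

Lemma foreign_uptoE k t P : (far_scale P <= t + k)%N ->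
  foreign_upto k t P = foreign t P.
Proof.
have stable n i : (far_scale P <= i + n)%N ->
    foreign_upto n.+1 i P = foreign_upto n i P.
  elim: n i => [|n IH] i Pi; first by rewrite !foreign_upto_far // -(addn0 i).
  by rewrite [LHS]/= -/(foreign_upto n.+1 i.+1 P) IH // addSnnS.
have stableD n m i : (far_scale P <= i + n)%N ->
    foreign_upto (m + n) i P = foreign_upto n i P.
  elim: m => [//|m IH] Pi; rewrite addSn stable ?IH //.
  by rewrite (leq_trans Pi) // leq_add2l leq_addl.
move=> Pk; rewrite -(stableD k (far_scale P) t Pk) addnC.
by rewrite stableD // leq_addl.
Qed.

Lemma foreignS t P : foreign t P = inherit (foreign t.+1 P) t (window t P).
Proof. by rewrite -(@foreign_uptoE (far_scale P).+1) // addnS leqW // leq_addl. Qed.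

Lemma foreign_window t P Q : window t P = window t Q -> foreign t P = foreign t Q.
Proof.
move=> PQ; pose k := maxn (far_scale P) (far_scale Q).
rewrite -(@foreign_uptoE k _ P) -1?(@foreign_uptoE k _ Q);
  try by rewrite (leq_trans _ (leq_addl _ _)) // leq_max leqnn ?orbT.
elim: k t PQ => //= k IH t PQ.
by rewrite PQ (IH t.+1) //; exact: window_succ.
Qed.

Definition drawn l j := foreign 0 (line_pt R l j) = Some l.

(** A window met by the foreign line of its parent inherits that line, which therefore survives down
    to scale 0. *)
Lemma drawn_foreign t l j : foreign t (line_pt R l j) = Some l -> drawn l j.
Proof.
elim: t => [//|t IH] h; apply: IH; rewrite foreignS h /=.
by case: asboolP => // -[]; exists j.
Qed.

Lemma drawn_own t c j :
  (forall l, foreign t.+1 (line_pt R (t.+1, c) j) = Some l ->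
     ~ hits l t (window t (line_pt R (t.+1, c) j))) ->
  drawn (t.+1, c) j.
Proof.
move=> h; apply: (@drawn_foreign t); rewrite foreignS /inherit own_line_pt.
by case: foreign h => [l|] // /(_ l erefl) nh; case: asboolP.
Qed.

End Foreign.

(** * The graph and its local connections *)

Section Vertices.
Variable R : realType.
Implicit Types (P Q : R * R) (l : line) (u v w : int * int).

Definition real_pt v : R * R := (v.1%:~R, v.2%:~R).

(** These vertices stay in place and form streets of spacing 2 for local moves; the others, with two
    odd coordinates, are available to carry points of lines. *)
Definition gridv v := (modz v.1 2 == 0) || (modz v.2 2 == 0).

(* At most 13 consecutive points of a line lie in an 8 x 8 cell; the 16 vertices of the
   cell with two odd coordinates receive the 16 points with index at least [fst_index]. *)
Definition fst_index l w : int :=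
  Num.floor ((8 * (swap_if (odd l.1) w).1)%:~R / cosine R l.1).

Definition slot v : int := 4 * divz (modz v.1 8) 2 + divz (modz v.2 8) 2.

Definition corner v : int * int := (2 * divz v.1 2, 2 * divz v.2 2).

(** The window test keeps displacements bounded; a vertex without a line point to carry is parked on
    a grid corner. *)
Definition vertex_pos v : R * R :=
  if gridv v then real_pt v else
  let w := window 0 (real_pt v) in
  if foreign 0 (real_pt v) is Some l then
    let z := line_pt R l (fst_index l w + slot v) in
    if window 0 z == w then z else real_pt (corner v)
  else real_pt (corner v).

Lemma window0_real_pt v : window 0 (real_pt v) = (divz v.1 8, divz v.2 8).
Proof.
have h (a : int) : Num.floor (a%:~R / 8 : R) = divz a 8.
  apply: floor_def; rewrite ler_pdivlMr // ltr_pdivrMr //.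
  by rewrite -[8 : R]/(8%:~R) -!intrM ler_int ltr_int; lia.
by rewrite /window /= !h.
Qed.

Lemma vertex_pos_drawn l j : drawn R l j -> exists v, vertex_pos v = line_pt R l j.
Proof.
move=> dr; pose z := line_pt R l j.
have [w Ew] : exists w, window 0 z = w by exists (window 0 z).
have [e Ee] : exists e : int, e = j - fst_index l w by exists (j - fst_index l w).
have : 0 <= e < 16.
  have [h1 h2] : 8 * (swap_if (odd l.1) w).1%:~R <= j%:~R * cosine R l.1 /\
      j%:~R * cosine R l.1 < 8 * (swap_if (odd l.1) w).1%:~R + 8.
    rewrite -Ew /z /line_pt window_swap swap_ifK /=.
    have /andP[] := floor_itv (j%:~R * cosine R l.1 / 8).
    by rewrite intrD ler_pdivlMr // ltr_pdivrMr //; split; lra.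
  have k0 := cosine_gt0 R l.1; have k1 := cosine_ge R l.1.
  have /andP[] := floor_itv ((8 * (swap_if (odd l.1) w).1)%:~R / cosine R l.1).
  rewrite -/(fst_index l w) ler_pdivlMr // ltr_pdivrMr // intrD intrM => h3 h4.
  (* In fact [e * cosine < 8 + cosine] and [cosine >= 2 / 3] give [e < 13]. *)
  suff : -1 < (e%:~R : R) < 16 by rewrite -[-1 : R]/((-1)%:~R) -[16 : R]/(16%:~R) !ltr_int; lia.
  rewrite Ee intrB; move: h1 h2 h3 h4 k1 k0; move: (cosine _ _) (swap_if _ _) (fst_index _ _).
  move=> k p i h1 h2 h3 h4 k1 k0; apply/andP; split.
    by rewrite -(ltr_pM2r k0); lra.
  rewrite -(ltr_pM2r k0); lra.
move=> /andP[e0 e16].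
(* The vertex of cell [w] with two odd coordinates whose [slot] is [e]. *)
pose v : int * int := (8 * w.1 + 2 * divz e 4 + 1, 8 * w.2 + 2 * modz e 4 + 1).
have wv : window 0 (real_pt v) = w.
  by rewrite window0_real_pt /= [RHS]surjective_pairing; congr pair; lia.
exists v; rewrite /vertex_pos wv.
have -> : gridv v = false by apply/negbTE; rewrite /gridv /=; lia.
rewrite (foreign_window (etrans wv (esym Ew))) (dr : foreign 0 z = _).
have -> : fst_index l w + slot v = j by rewrite /slot /=; lia.
by rewrite -/z Ew eqxx.
Qed.

Lemma vertex_pos_near v :
  (`|(vertex_pos v).1 - v.1%:~R| <= 8) /\ (`|(vertex_pos v).2 - v.2%:~R| <= 8).
Proof.
rewrite /vertex_pos; case: ifP => [_|_]; first by rewrite /= !subrr normr0.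
have hc : (`|(real_pt (corner v)).1 - v.1%:~R| <= 8) /\
    (`|(real_pt (corner v)).2 - v.2%:~R| <= 8).
  by rewrite /= -!intrB -!intr_norm -[8 : R]/(8%:~R) !ler_int; lia.
case: foreign => [l|] //; case: eqP => // /window_near /= [h1 h2].
by split; apply: ltW.
Qed.

Definition vadj u v := (u != v) && (dst (vertex_pos u) (vertex_pos v) <= 1).

Lemma vadj_sym : symmetric vadj.
Proof. by move=> u v; rewrite /vadj eq_sym dst_sym. Qed.

Lemma vadj_irrefl : irreflexive vadj.
Proof. by move=> u; rewrite /vadj eqxx. Qed.

Definition highway_graph := SimpleGraph vadj_sym vadj_irrefl.

(** Source of the lower bound on graph distances: an edge moves the position by at most 1. *)
Lemma path_dst u s :
  path highway_graph u s -> dst (vertex_pos u) (vertex_pos (last u s)) <= (size s)%:R.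
Proof.
elim: s u => [|v s IH] u /=; first by rewrite /dst !subrr expr0n addr0 sqrtr0.
move=> /andP[/andP[_ uv] /IH h]; apply: le_trans (dst_triangle (vertex_pos v) _ _) _.
by rewrite -natr1 addrC lerD.
Qed.

(** Vertices may repeat, so that walks concatenate freely; simple paths are extracted only at the
    end. *)
Definition reach u v (x : R) :=
  exists s, [/\ path highway_graph u s, last u s = v & (size s)%:R <= x].

Lemma reach_refl u x : 0 <= x -> reach u u x.
Proof. by move=> x0; exists [::]. Qed.

Lemma reach_le u v x y : reach u v x -> x <= y -> reach u v y.
Proof. by move=> [s [h1 h2 h3]] xy; exists s; split=> //; exact: le_trans xy. Qed.

Lemma reach_trans v u w x y : reach u v x -> reach v w y -> reach u w (x + y).
Proof.
move=> [s [h1 h2 h3]] [s' [k1 k2 k3]]; exists (s ++ s').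
by rewrite cat_path last_cat h2 h1 k1 k2 size_cat natrD lerD.
Qed.

Lemma reach_sym u v x : reach u v x -> reach v u x.
Proof.
move=> [s [h1 <- h3]]; exists (rev (belast u s)); rewrite rev_path size_rev size_belast.
split=> //; last by case: s {h1 h3} => //= w s; rewrite rev_cons last_rcons.
by rewrite (eq_path (e' := highway_graph)) // => a b; exact: vadj_sym.
Qed.

Lemma reach_adj u v : dst (vertex_pos u) (vertex_pos v) <= 1 -> reach u v 1.
Proof.
move=> h; have [->|uv] := eqVneq u v; first exact: reach_refl.
by exists [:: v]; rewrite /= /vadj uv h.
Qed.

Lemma vertex_pos_grid v : gridv v -> vertex_pos v = real_pt v.
Proof. by rewrite /vertex_pos => ->. Qed.

Lemma reach_grid_step u v : gridv u -> gridv v ->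
  `|u.1 - v.1| + `|u.2 - v.2| <= 1 -> reach u v 1.
Proof.
move=> gu gv uv; apply: reach_adj; rewrite !vertex_pos_grid //.
apply: le_trans (dst_le_l1 _ _) _.
by rewrite /= -!intrB -!intr_norm -intrD -[1 : R]/(1%:~R) ler_int.
Qed.

Lemma reach_row (a a' b : int) : modz b 2 = 0 -> reach (a, b) (a', b) `|a - a'|%:~R.
Proof.
move=> b0; have h (n : nat) c : reach (c, b) (c + n%:Z, b) n%:R.
  elim: n => [|n IH]; first by rewrite addr0; exact: reach_refl.
  rewrite -natr1; apply: reach_trans IH _.
  by apply: reach_grid_step; rewrite /gridv /= ?b0 ?eqxx ?orbT //; lia.
have [aa'|aa'] := lerP a a'.
  have := h `|a' - a|%N a; rewrite (_ : a + _ = a'); last lia.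
  by move=> /reach_le; apply; rewrite pmulrn ler_int; lia.
apply: reach_sym; have := h `|a - a'|%N a'; rewrite (_ : a' + _ = a); last lia.
by move=> /reach_le; apply; rewrite pmulrn ler_int; lia.
Qed.

Lemma reach_col (a b b' : int) : modz a 2 = 0 -> reach (a, b) (a, b') `|b - b'|%:~R.
Proof.
move=> a0; have h (n : nat) c : reach (a, c) (a, c + n%:Z) n%:R.
  elim: n => [|n IH]; first by rewrite addr0; exact: reach_refl.
  rewrite -natr1; apply: reach_trans IH _.
  by apply: reach_grid_step; rewrite /gridv /= ?a0 ?eqxx //; lia.
have [bb'|bb'] := lerP b b'.
  have := h `|b' - b|%N b; rewrite (_ : b + _ = b'); last lia.
  by move=> /reach_le; apply; rewrite pmulrn ler_int; lia.
apply: reach_sym; have := h `|b - b'|%N b'; rewrite (_ : b' + _ = b); last lia.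
by move=> /reach_le; apply; rewrite pmulrn ler_int; lia.
Qed.

Definition base P : int * int := (2 * Num.floor (P.1 / 2), 2 * Num.floor (P.2 / 2)).

(** Rounding to even grid corners makes walks comparable between arbitrary points of the plane, so
    waypoints need not be positions of vertices. *)
Definition near P Q x := reach (base P) (base Q) x.

Lemma near_trans Q P P' x y : near P Q x -> near Q P' y -> near P P' (x + y).
Proof. exact: reach_trans. Qed.

Lemma near_sym P Q x : near P Q x -> near Q P x.
Proof. exact: reach_sym. Qed.

Lemma near_le P Q x y : near P Q x -> x <= y -> near P Q y.
Proof. exact: reach_le. Qed.

(** One walks along an even row, then an even column; rounding both ends adds at most 2 per
    coordinate. *)
Lemma near_l1 P Q : near P Q (`|P.1 - Q.1| + `|P.2 - Q.2| + 4).
Proof.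
have fl (x y : R) :
    `|2 * Num.floor (x / 2) - 2 * Num.floor (y / 2)|%:~R <= `|x - y| + 2.
  have /andP[] := floor_itv (x / 2); have /andP[] := floor_itv (y / 2).
  rewrite intr_norm intrB !intrM !intrD; move: (Num.floor _) (Num.floor _) => m n.
  have := ler_norm (x - y); have := ler_norm (y - x); rewrite distrC.
  by move=> *; rewrite ler_norml; apply/andP; split; lra.
apply: (@reach_le _ _ (`|2 * Num.floor (P.1 / 2) - 2 * Num.floor (Q.1 / 2)|%:~R +
   `|2 * Num.floor (P.2 / 2) - 2 * Num.floor (Q.2 / 2)|%:~R)).
  apply: (@reach_trans (2 * Num.floor (Q.1 / 2), 2 * Num.floor (P.2 / 2))).
    by apply: reach_row; lia.
  by apply: reach_col; lia.
by have := fl P.1 Q.1; have := fl P.2 Q.2; lra.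
Qed.

Lemma reach_base v : reach v (base (vertex_pos v)) 4.
Proof.
set z := vertex_pos v; pose i := Num.floor (z.1 / 2); pose k := Num.floor (z.2 / 2).
(* One edge leads to the grid vertex; as [a + b] is odd, hence at most 3, three more reach the
   base. *)
have near_grid (a b : int) : 0 <= a <= 2 -> 0 <= b <= 2 -> modz (a + b) 2 = 1 ->
    (z.1 - (2 * i%:~R + a%:~R)) ^+ 2 + (z.2 - (2 * k%:~R + b%:~R)) ^+ 2 <= 1 ->
    reach v (base z) 4.
  move=> ha hb hab d.
  have g : gridv (2 * i + a, 2 * k + b) by rewrite /gridv /=; lia.
  apply: (@reach_le _ _ (1 + 3)); last lra.
  apply: (@reach_trans (2 * i + a, 2 * k + b)).
    by apply: reach_adj; rewrite (vertex_pos_grid g) dst_le //= !intrD !intrM expr1n.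
  have [b0|b1] := eqVneq (modz b 2) 0.
    apply: (@reach_le _ _ (`|2 * i + a - 2 * i|%:~R + `|2 * k + b - 2 * k|%:~R)).
      apply: (@reach_trans (2 * i, 2 * k + b)); first by apply: reach_row; lia.
      by apply: reach_col; lia.
    by rewrite -intrD -[3 : R]/(3%:~R) ler_int; lia.
  apply: (@reach_le _ _ (`|2 * k + b - 2 * k|%:~R + `|2 * i + a - 2 * i|%:~R)).
    apply: (@reach_trans (2 * i + a, 2 * k)); first by apply: reach_col; lia.
    by apply: reach_row; lia.
  by rewrite -intrD -[3 : R]/(3%:~R) ler_int; lia.
have /andP[] := floor_itv (z.1 / 2); have /andP[] := floor_itv (z.2 / 2).
rewrite -/i -/k !intrD => k1 k2 i1 i2.
pose x := z.1 - 2 * i%:~R; pose y := z.2 - 2 * k%:~R.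
have hx : 0 <= x < 2 by apply/andP; rewrite /x; split; lra.
have hy : 0 <= y < 2 by apply/andP; rewrite /y; split; lra.
have [/andP[x0 x2] /andP[y0 y2]] := (hx, hy).
pose n01 := near_grid 0 1 isT isT erefl; pose n10 := near_grid 1 0 isT isT erefl.
pose n21 := near_grid 2 1 isT isT erefl; pose n12 := near_grid 1 2 isT isT erefl.
have ex (c : int) : z.1 - (2 * i%:~R + c%:~R) = x - c%:~R by rewrite /x; ring.
have ey (c : int) : z.2 - (2 * k%:~R + c%:~R) = y - c%:~R by rewrite /y; ring.
move: n01 n10 n21 n12; rewrite !ex !ey => n01 n10 n21 n12.
(* The diagonals cut the 2 x 2 square into four triangles, each within distance 1 of the midpoint of
   its side of the square. *)
have [xy|xy] := lerP x y; have [xy'|xy'] := lerP (x + y) 2.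
- by apply: n01; rewrite -[0%:~R]/(0 : R) -[1%:~R]/(1 : R); nra.
- by apply: n12; rewrite -[2%:~R]/(2 : R) -[1%:~R]/(1 : R); nra.
- by apply: n10; rewrite -[0%:~R]/(0 : R) -[1%:~R]/(1 : R); nra.
- by apply: n21; rewrite -[2%:~R]/(2 : R) -[1%:~R]/(1 : R); nra.
Qed.

End Vertices.

(** * Travelling along lines *)

Section Travel.
Variable R : realType.
Implicit Types (P Q : R * R) (l : line) (i j c : int) (n k : nat).
Local Notation pt := (line_pt R).

Lemma near_dst P Q : near P Q (2 * dst P Q + 4).
Proof.
apply: near_le (near_l1 P Q) _; have [h1 h2] := dst_ge_abs P Q; lra.
Qed.

Lemma near_step l j : near (pt l j) (pt l (j + 1)) 6.
Proof.
apply: near_le (near_dst _ _) _; rewrite dst_line_pt.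
by rewrite (_ : `|j - (j + 1)| = 1); [lra|lia].
Qed.

Lemma near_drawn l i n : (forall k, (k <= n)%N -> drawn R l (i + k)) ->
  near (pt l i) (pt l (i + n)) (n%:R + 8).
Proof.
move=> dr; suff [u [v [hu hv uv]]] : exists u v : int * int,
    [/\ vertex_pos R u = pt l i, vertex_pos R v = pt l (i + n) & reach u v (n%:R : R)].
  rewrite -hu -hv; have -> : n%:R + 8 = 4 + n%:R + 4 :> R by ring.
  apply: (@reach_trans R v); last exact: reach_base.
  apply: (@reach_trans R u) => //; apply: reach_sym; exact: reach_base.
elim: n dr => [|n IH] dr.
  have [u hu] := vertex_pos_drawn (dr 0 isT); exists u, u.
  by rewrite -{1}[i]addr0 hu; split=> //; exact: reach_refl.
have [|u [v [hu hv uv]]] := IH; first by move=> k kn; apply: dr; exact: leqW.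
have [v' hv'] := vertex_pos_drawn (dr n.+1 (leqnn _)); exists u, v'; split=> //.
rewrite -natr1; apply: reach_trans uv _; apply: reach_adj.
rewrite hv hv' dst_line_pt (_ : `|_| = 1) //; lia.
Qed.

(* Inside a window of scale [t.+1] the line is interrupted only by the foreign line of the
   window, which is followed between the first and the last subwindow it hits. *)
Lemma near_in_window t c i n :
  window t.+1 (pt (t.+1, c) i) = window t.+1 (pt (t.+1, c) (i + n)) ->
  near (pt (t.+1, c) i) (pt (t.+1, c) (i + n)) (n%:R + 14 * (side t)%:R).
Proof.
move=> hw; pose z k := pt (t.+1, c) (i + k%:Z); have L8 := side_ge8 R t.
have zw k : (k <= n)%N -> window t.+1 (z k) = window t.+1 (pt (t.+1, c) i).
  by move=> kn; apply: line_pt_convex hw; lia.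
(* Over a stretch of subwindows missed by the foreign line, the line itself is drawn. *)
have chain k0 m : (k0 + m <= n)%N ->
    (forall k s, (k0 <= k <= k0 + m)%N ->
      foreign t.+1 (pt (t.+1, c) i) = Some s -> ~ hits R s t (window t (z k))) ->
    near (z k0) (z (k0 + m)%N) (m%:R + 8).
  move=> kmn free; rewrite /z PoszD addrA; apply: near_drawn => k km.
  rewrite -addrA -PoszD; apply: drawn_own => s.
  rewrite (foreign_window (zw (k0 + k)%N _)); last lia.
  by apply: free; lia.
have zS k : near (z k) (z k.+1) 6.
  by have := near_step (t.+1, c) (i + k); rewrite -addrA (_ : k%:Z + 1 = k.+1) //; lia.
have z0 : pt (t.+1, c) i = z 0 by rewrite /z addr0.
have whole : (forall k s, (k <= n)%N ->
    foreign t.+1 (pt (t.+1, c) i) = Some s -> ~ hits R s t (window t (z k))) ->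
    near (z 0) (z n) (n%:R + 14 * (side t)%:R).
  move=> free; apply: near_le (chain 0 n (leqnn _) _) _; last lra.
  by move=> k s /andP[_ kn]; exact: free.
rewrite z0 -/(z n).
case E: (foreign t.+1 (pt (t.+1, c) i)) => [s|]; last first.
  by apply: whole => k s kn; rewrite E.
pose B := [pred k | (k <= n)%N && `[< hits R s t (window t (z k)) >]].
have [exB|noB] := pselect (exists k, B k); last first.
  apply: whole => k s'; rewrite E => kn [<-] h; apply: noB; exists k.
  by rewrite /= kn; apply/asboolP.
have ubB k : B k -> (k <= n)%N by case/andP.
case: (ex_minnP exB) => k1 /andP[k1n /asboolP[j1 hj1]] min1.
case: (ex_maxnP exB ubB) => k2 /andP[k2n /asboolP[j2 hj2]] max2.
have k12 : (k1 <= k2)%N by apply: min1; rewrite /= k2n; apply/asboolP; exists j2.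
have free k s' : (k <= n)%N -> ~ B k -> foreign t.+1 (pt (t.+1, c) i) = Some s' ->
    ~ hits R s' t (window t (z k)).
  by rewrite E => kn nB [<-] h; apply: nB; rewrite /= kn; apply/asboolP.
have leg1 : near (z 0) (z k1) (k1%:R + 14).
  case: k1 k1n hj1 min1 k12 => [|k1] k1n hj1 min1 k12.
    by apply: near_le (near_dst _ _) _; rewrite /dst !subrr expr0n addr0 sqrtr0; lra.
  have -> : k1.+1%:R + 14 = (k1%:R + 8) + 7 :> R by rewrite -natr1; ring.
  apply: (@near_trans _ (z k1)).
    apply: (chain 0); first lia.
    move=> k s' kk; apply: free; first lia.
    by move=> /min1; lia.
  apply: near_le (zS _) _; lra.
have leg3 : near (z k2) (z n) ((n - k2)%N%:R + 14).
  have [->|k2n'] := eqVneq k2 n.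
    by apply: near_le (near_dst _ _) _; rewrite /dst !subrr expr0n addr0 sqrtr0 subnn; lra.
  have -> : (n - k2)%N%:R + 14 = 7 + ((n - k2.+1)%N%:R + 8) :> R.
    by rewrite (_ : (n - k2 = (n - k2.+1).+1)%N) -?natr1; [ring|lia].
  apply: (@near_trans _ (z k2.+1)).
    apply: near_le (zS _) _; lra.
  have := chain k2.+1 (n - k2.+1)%N; rewrite subnKC; last lia.
  apply=> // k s' kk; apply: free; first lia.
  by move=> /max2; lia.
have d1 := window_near hj1; have d2 := window_near hj2.
have dl1 := dst_le_l1 (pt s j1) (z k1); have dl2 := dst_le_l1 (pt s j2) (z k2).
(* Both ends lie in the same window of scale [t.+1], so by convexity the whole segment of [s] does,
   and there [s] is the foreign line. *)
have follow a b k m : a <= b -> (k <= n)%N -> (m <= n)%N ->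
    window t (pt s a) = window t (z k) -> window t (pt s b) = window t (z m) ->
    near (pt s a) (pt s b) (`|a - b|%:~R + 8).
  move=> ab kn mn ha hb; have bE : b = a + `|a - b|%N by lia.
  rewrite (_ : `|a - b| = Posz `|a - b|%N); last lia.
  rewrite -pmulrn {1}bE; apply: near_drawn => k' kk.
  apply: (@drawn_foreign _ t.+1); rewrite -E; apply: foreign_window.
  have wa : window t.+1 (pt s a) = window t.+1 (pt (t.+1, c) i) by rewrite (window_succ ha) zw.
  have wb : window t.+1 (pt s b) = window t.+1 (pt (t.+1, c) i) by rewrite (window_succ hb) zw.
  by rewrite -wa; apply: (@line_pt_convex _ _ _ _ _ b); [lia|rewrite wa].
have mid : near (pt s j1) (pt s j2) (`|j1 - j2|%:~R + 8).
  case/orP: (le_total j1 j2) => jj; first exact: follow jj k1n k2n hj1 hj2.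
  by rewrite distrC; apply: near_sym; exact: follow jj k2n k1n hj2 hj1.
(* Points of [s] are unit-spaced, so the index gap is a Euclidean distance and the triangle
   inequality applies. *)
have jbound : `|j1 - j2|%:~R <= (k2 - k1)%N%:R + 4 * (side t)%:R :> R.
  rewrite -(dst_line_pt R s); have := dst_triangle (z k1) (pt s j1) (pt s j2).
  have := dst_triangle (z k2) (z k1) (pt s j2); rewrite [dst (z k2) _]dst_sym.
  have -> : dst (z k1) (z k2) = (k2 - k1)%N%:R by rewrite dst_line_pt pmulrn; congr _%:~R; lia.
  lra.
have e : k1%:R + (k2 - k1)%N%:R + (n - k2)%N%:R = n%:R :> R.
  by rewrite -!natrD; congr _%:R; lia.
have leg12 : near (z k1) (pt s j1) (2 * (side t)%:R + 4).
  by apply: near_sym; apply: near_le (near_l1 _ _) _; lra.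
have leg23 : near (pt s j2) (z k2) (2 * (side t)%:R + 4).
  by apply: near_le (near_l1 _ _) _; lra.
(* The five legs add up to at most [n + 8 * side t + 44], and [side t >= 8]. *)
apply: near_le (near_trans leg1 (near_trans leg12 (near_trans mid (near_trans leg23 leg3)))) _.
lra.
Qed.

(** The sign follows the slope, so that the count never decreases along the line and grows whenever
    the window changes. *)
Definition window_count T l j : int :=
  let w := window T (axis_pt R l j) in if 0 <= slope R l.1 then w.1 + w.2 else w.1 - w.2.

Lemma window_count_mono T l i j : i <= j ->
  (window_count T l i <= window_count T l j) /\
  (window_count T l i = window_count T l j -> window T (pt l i) = window T (pt l j)).
Proof.
move=> ij; have k0 := cosine_gt0 R l.1; have L0 := side_gt0 R T.
have le1 : i%:~R * cosine R l.1 <= j%:~R * cosine R l.1 by rewrite ler_pM2r // ler_int.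
have f1 : (window T (axis_pt R l i)).1 <= (window T (axis_pt R l j)).1.
  by apply: le_floor; rewrite ler_pM2r ?invr_gt0.
rewrite /window_count; case: (lerP 0 (slope R l.1)) => s0.
  have f2 : (window T (axis_pt R l i)).2 <= (window T (axis_pt R l j)).2.
    by apply: le_floor; rewrite ler_pM2r ?invr_gt0 //= lerD2r ler_wpM2l.
  split; first exact: lerD.
  move=> e; apply/window_line_pt; rewrite [LHS]surjective_pairing [RHS]surjective_pairing.
  by congr pair; lia.
have f2 : (window T (axis_pt R l j)).2 <= (window T (axis_pt R l i)).2.
  by apply: le_floor; rewrite ler_pM2r ?invr_gt0 //= lerD2r ler_wnM2l // ltW.
split; first lia.
move=> e; apply/window_line_pt; rewrite [LHS]surjective_pairing [RHS]surjective_pairing.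
by congr pair; lia.
Qed.

Lemma window_count_le T l i n :
  (window_count T l (i + n) - window_count T l i)%:~R <= 2 * n%:R / (side T)%:R + 2 :> R.
Proof.
have L0 := side_gt0 R T; have [d1 d2] := dst_ge_abs (axis_pt R l (i + n)) (axis_pt R l i).
have dn : dst (axis_pt R l (i + n)) (axis_pt R l i) = n%:R.
  rewrite -(dst_swap (odd l.1)) -/(line_pt R l _) dst_line_pt pmulrn; congr _%:~R; lia.
rewrite dn in d1 d2.
have fl (x y : R) : `|x - y| <= n%:R ->
    (Num.floor (x / (side T)%:R))%:~R <=
      (Num.floor (y / (side T)%:R))%:~R + n%:R / (side T)%:R + 1 :> R.
  move=> xy; have := floor_le (x / (side T)%:R); have := floorD1_gt (y / (side T)%:R).
  rewrite intrD => h1 h2.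
  have : (x - y) / (side T)%:R <= n%:R / (side T)%:R.
    by rewrite ler_pM2r ?invr_gt0 //; apply: le_trans xy; exact: ler_norm.
  by rewrite mulrBl; lra.
rewrite intrB /window_count; case: ifP => _; rewrite ?intrB ?intrD /=.
  by have := fl _ _ d1; have := fl _ _ d2; lra.
rewrite distrC in d2.
by have := fl _ _ d1; have := fl _ _ d2; lra.
Qed.

(** Induction on the number of window changes: go to the last point of the first window, then take
    one step. Each window wastes at most [14 * side t + 6 <= 15 * side t]. *)
Lemma near_line_aux t c N i n :
  window_count t.+1 (t.+1, c) (i + n) - window_count t.+1 (t.+1, c) i <= N%:Z ->
  near (pt (t.+1, c) i) (pt (t.+1, c) (i + n)) (n%:R + (N%:R + 1) * (15 * (side t)%:R)).
Proof.
set l := (t.+1, c); have L8 := side_ge8 R t.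
elim: N i n => [|N IH] i n hN; have [le_in eq_in] := @window_count_mono t.+1 l i (i + n) ltac:(lia).
  apply: near_le (near_in_window (eq_in _)) _; first lia.
  by rewrite add0r mul1r; lra.
pose B := [pred k | (k <= n)%N && (window_count t.+1 l (i + k%:Z) == window_count t.+1 l i)].
have exB : exists k, B k by exists 0%N; rewrite /= addr0 eqxx.
have ubB k : B k -> (k <= n)%N by case/andP.
case: (ex_maxnP exB ubB) => k /andP[kn /eqP ek] maxk.
have [_ /(_ (esym ek)) wk] := @window_count_mono t.+1 l i (i + k) ltac:(lia).
have h1 := near_in_window wk.
have N0 : 0 <= N%:R :> R by rewrite ler0n.
have [kn'|kn'] := eqVneq k n.
  by rewrite -kn'; apply: near_le h1 _; rewrite -natr1; nra.
have [le_k _] := @window_count_mono t.+1 l i (i + k.+1) ltac:(lia).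
have lt_k : window_count t.+1 l (i + k.+1) != window_count t.+1 l i.
  apply/eqP => e; have : B k.+1 by rewrite /= e eqxx andbT; lia.
  by move=> /maxk; lia.
have := IH (i + k.+1) (n - k.+1)%N.
rewrite -addrA -PoszD subnKC; last lia.
have {}lt_k : window_count t.+1 l i < window_count t.+1 l (i + k.+1).
  by rewrite lt_neqAle eq_sym lt_k.
have hN' : window_count t.+1 l (i + n) - window_count t.+1 l (i + k.+1) <= N.
  move: hN lt_k; set x := window_count _ _ i; set y := window_count _ _ (i + n).
  set z := window_count _ _ _.
  move: x y z => x y z; lia.
move=> /(_ hN') {}IH.
have h2 := near_step l (i + k); rewrite -addrA -PoszD addn1 in h2.
apply: near_le (near_trans h1 (near_trans h2 IH)) _.
have -> : n%:R = k%:R + 1 + (n - k.+1)%N%:R :> R.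
  by rewrite natr1 -natrD; congr _%:R; lia.
by rewrite -natr1; lra.
Qed.

(** At most [2 * n / side t.+1 + 3] windows are visited, each wasting [15 * side t], and
    [side t.+1 = (t + 8) * side t]. *)
Lemma near_line t c i n : near (pt (t.+1, c) i) (pt (t.+1, c) (i + n))
  (n%:R + 30 * n%:R / (t%:R + 8) + 45 * (side t)%:R).
Proof.
pose N := `|window_count t.+1 (t.+1, c) (i + n) - window_count t.+1 (t.+1, c) i|%N.
have [le_in _] := @window_count_mono t.+1 (t.+1, c) i (i + n) ltac:(lia).
apply: near_le (@near_line_aux t c N i n _) _; first by rewrite /N; lia.
have := window_count_le t.+1 (t.+1, c) i n.
have -> : window_count t.+1 (t.+1, c) (i + n) - window_count t.+1 (t.+1, c) i = N%:Z.
  by rewrite /N; lia.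
rewrite -pmulrn sideSr => hN; have L8 := side_ge8 R t.
have t8 : 0 < t%:R + 8 :> R by have := ler0n R t; lra.
have : (N%:R + 1) * (15 * (side t)%:R) <=
    (2 * n%:R / ((t%:R + 8) * (side t)%:R) + 2 + 1) * (15 * (side t)%:R) :> R.
  by apply: ler_wpM2r; lra.
have -> : (2 * n%:R / ((t%:R + 8) * (side t)%:R) + 2 + 1) * (15 * (side t)%:R) =
    30 * n%:R / (t%:R + 8) + 45 * (side t)%:R :> R.
  by field; apply/andP; split; apply/eqP; lra.
lra.
Qed.

(** One moves to the line of scale [t.+1] whose strip contains [P], follows it, and leaves it; the
    spacing [side t.+1] of the lines bounds both transfers. *)
Lemma near_travel t P (x : R) : 0 <= x ->
  let d := x * Num.sqrt (1 + slope R t.+1 ^+ 2) in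
  let v := swap_if (odd t.+1) (x, slope R t.+1 * x) in
  near P (P.1 + v.1, P.2 + v.2) (d + 30 * d / (t%:R + 8) + 10 * (side t.+1)%:R).
Proof.
move=> x0 d v; pose s := slope R t.+1; pose k := cosine R t.+1; pose b := odd t.+1.
pose l := (side t.+1)%:R : R; pose p := swap_if b P.
have k0 : 0 < k := cosine_gt0 _ _; have k1 : k <= 1 := cosine_le1 _ _.
have l0 : 0 < l := side_gt0 _ _; have s1 : `|s| <= 1 := slope_le1 _ _.
pose c := Num.floor ((p.2 - s * p.1) / l).
pose j := Num.floor (p.1 / k); pose n := Num.truncn (x / k).
have xk : 0 <= x / k by rewrite divr_ge0 // ltW.
have dE : d = x / k by rewrite /k /cosine invrK.
have hj : `|p.1 - j%:~R * k| <= 1.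
  have /andP[] := floor_itv (p.1 / k); rewrite -/j intrD ler_pdivlMr // ltr_pdivrMr //.
  by move=> *; rewrite ler_norml; apply/andP; split; lra.
have hn : `|x - n%:R * k| <= 1.
  have /andP[] := truncn_itv xk; rewrite -/n -natr1 ler_pdivlMr // ltr_pdivrMr //.
  by move=> *; rewrite ler_norml; apply/andP; split; lra.
have hc : `|p.2 - s * p.1 - (c%:~R + 2^-1) * l| <= l.
  have /andP[] := floor_itv ((p.2 - s * p.1) / l).
  rewrite -/c intrD ler_pdivlMr // ltr_pdivrMr //.
  by move=> *; rewrite ler_norml; apply/andP; split; lra.
have sle (y : R) : `|s * y| <= `|y|.
  by rewrite normrM -[leRHS]mul1r ler_wpM2r.
have close (y : R) (i : int) : `|p.1 + y - i%:~R * k| <= 2 ->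
    near (P.1 + (swap_if b (y, s * y)).1, P.2 + (swap_if b (y, s * y)).2) (pt (t.+1, c) i)
      (l + 8).
  move=> hy; set Q := (X in near X).
  have qE : swap_if b Q = (p.1 + y, p.2 + s * y).
    by rewrite /Q /p; case: (b).
  apply: near_le (near_l1 _ _) _.
  have -> : `|Q.1 - (pt (t.+1, c) i).1| + `|Q.2 - (pt (t.+1, c) i).2| =
     `|(swap_if b Q).1 - (axis_pt R (t.+1, c) i).1| +
     `|(swap_if b Q).2 - (axis_pt R (t.+1, c) i).2|.
    by rewrite /line_pt -/b; case: (b) => //=; rewrite addrC.
  rewrite qE /= -/s -/k -/l.
  have -> : p.2 + s * y - (s * (i%:~R * k) + (c%:~R + 2^-1) * l) =
     (p.2 - s * p.1 - (c%:~R + 2^-1) * l) + s * (p.1 + y - i%:~R * k) by ring.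
  have := ler_normD (p.2 - s * p.1 - (c%:~R + 2^-1) * l) (s * (p.1 + y - i%:~R * k)).
  have := sle (p.1 + y - i%:~R * k); lra.
have h1 : near P (pt (t.+1, c) j) (l + 8).
  have := close 0 j; rewrite !addr0 mulr0.
  rewrite (_ : swap_if b (0, 0) = (0, 0)); last by case: (b).
  by rewrite /= !addr0 -surjective_pairing; apply; lra.
have h3 : near (pt (t.+1, c) (j + n)) (P.1 + v.1, P.2 + v.2) (l + 8).
  apply: near_sym; apply: close.
  have -> : p.1 + x - (j + n)%:~R * k = (p.1 - j%:~R * k) + (x - n%:R * k).
    by rewrite intrD -pmulrn; ring.
  by apply: le_trans (ler_normD _ _) _; lra.
apply: near_le (near_trans h1 (near_trans (near_line _ _ _ _) h3)) _.
have nd : n%:R <= d by rewrite dE truncn_le.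
have t8 : 0 < t%:R + 8 :> R by have := ler0n R t; lra.
have : 30 * n%:R / (t%:R + 8) <= 30 * d / (t%:R + 8).
  by rewrite ler_pM2r ?invr_gt0 // ler_pM2l.
have := sideS_ge8 R t; have := side_ge8 R t; rewrite -/l; lra.
Qed.

End Travel.

(** * Decomposition into two directions and numerical estimates *)

Section Distance.
Variable R : realType.

(** Second-order Taylor bound: the second derivative of [Num.sqrt (1 + s ^+ 2)] is at most 1. *)
Lemma sqrt_tangent (s h : R) : Num.sqrt (1 + (s + h) ^+ 2) <=
  Num.sqrt (1 + s ^+ 2) + s * h / Num.sqrt (1 + s ^+ 2) + h ^+ 2 / 2.
Proof.
have s2 := sqr_ge0 s; have h2 := sqr_ge0 h.
set a := Num.sqrt (1 + s ^+ 2).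
have a2 : a ^+ 2 = 1 + s ^+ 2 by rewrite sqr_sqrtr; lra.
have a1 : 1 <= a by rewrite -sqrtr1 ler_sqrt; lra.
have sa : `|s| <= a.
  by rewrite -(@ler_pXn2r _ 2) ?nnegrE ?real_normK ?num_real ?a2 //; lra.
pose q := s * h / a.
have qa : q * a = s * h by rewrite /q divfK //; apply/eqP; lra.
have qh : `|q| <= `|h|.
  rewrite /q mulrAC normrM; apply: ler_piMl => //.
  by rewrite normrM normfV [`|a|]ger0_norm ?ler_pdivrMr ?mul1r; lra.
have pos : 0 <= a + q + h ^+ 2 / 2.
  have : - `|h| <= q by have := ler_norm (- q); rewrite normrN; lra.
  have : `|h| <= 2^-1 + h ^+ 2 / 2.
    by rewrite -[h ^+ 2](real_normK (num_real _)); have := sqr_ge0 (`|h| - 1); lra.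
  by lra.
rewrite -(@ler_pXn2r _ 2) ?nnegrE ?sqrtr_ge0 // sqr_sqrtr; last first.
  by have := sqr_ge0 (s + h); lra.
have e : (a + q + h ^+ 2 / 2) ^+ 2 =
    a ^+ 2 + 2 * (q * a) + a * h ^+ 2 + (q + h ^+ 2 / 2) ^+ 2 by field.
rewrite e qa a2; have := sqr_ge0 (q + h ^+ 2 / 2).
have : h ^+ 2 <= a * h ^+ 2 by rewrite ler_peMl.
have -> : (s + h) ^+ 2 = s ^+ 2 + 2 * (s * h) + h ^+ 2 by ring.
lra.
Qed.

(** The tangent bound is taken at the weighted mean slope [s], where the linear terms cancel; the
    loss is therefore quadratic in [e]. *)
Lemma sqrt_two_slopes (x1 x2 s1 s2 e : R) : 0 <= x1 -> 0 <= x2 ->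
  0 <= e -> s2 = s1 + e ->
  x1 * Num.sqrt (1 + s1 ^+ 2) + x2 * Num.sqrt (1 + s2 ^+ 2) <=
  Num.sqrt ((x1 + x2) ^+ 2 + (x1 * s1 + x2 * s2) ^+ 2) + (x1 + x2) * e ^+ 2 / 2.
Proof.
move=> x10 x20 e0 s2E; set y := x1 * s1 + x2 * s2.
have [x0|x0] := eqVneq (x1 + x2) 0.
  have x1E : x1 = 0 by lra.
  have x2E : x2 = 0 by lra.
  by rewrite x1E x2E !mul0r !addr0 addr_ge0 ?sqrtr_ge0 //; lra.
have xp : 0 < x1 + x2 by rewrite lt_neqAle eq_sym x0 addr_ge0.
pose s := y / (x1 + x2).
have sx : s * (x1 + x2) = y by rewrite /s divfK.
have -> : Num.sqrt ((x1 + x2) ^+ 2 + y ^+ 2) = (x1 + x2) * Num.sqrt (1 + s ^+ 2).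
  rewrite -[X in X * _]ger0_norm ?(ltW xp) // -sqrtr_sqr -sqrtrM ?sqr_ge0 //.
  by rewrite -sx; congr Num.sqrt; ring.
have b1 : 0 <= s - s1 <= e.
  have -> : s - s1 = x2 * e / (x1 + x2) by rewrite /s /y s2E; field; apply/eqP; lra.
  by rewrite divr_ge0 ?mulr_ge0 ?(ltW xp) //= ler_pdivrMr //; nra.
have sq1 : (s1 - s) ^+ 2 <= e ^+ 2 by move: b1 => /andP[]; nra.
have sq2 : (s2 - s) ^+ 2 <= e ^+ 2 by move: b1 => /andP[]; nra.
have t1 := sqrt_tangent s (s1 - s); have t2 := sqrt_tangent s (s2 - s).
rewrite subrKC in t1; rewrite subrKC in t2.
move: t1 t2; set A := Num.sqrt (1 + s ^+ 2) => t1 t2.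
have t1' : x1 * Num.sqrt (1 + s1 ^+ 2) <= x1 * (A + s * (s1 - s) / A + e ^+ 2 / 2).
  by apply: ler_wpM2l => //; lra.
have t2' : x2 * Num.sqrt (1 + s2 ^+ 2) <= x2 * (A + s * (s2 - s) / A + e ^+ 2 / 2).
  by apply: ler_wpM2l => //; lra.
have : x1 * (s * (s1 - s) / A) + x2 * (s * (s2 - s) / A) = 0.
  have -> : x1 * (s * (s1 - s) / A) + x2 * (s * (s2 - s) / A) =
    (y - s * (x1 + x2)) * (s / A) by rewrite /y; ring.
  by rewrite sx subrr mul0r.
lra.
Qed.

Lemma slope_bracket (m : nat) (x y : R) : (0 < m)%N -> `|y| <= x ->
  exists a : int, [/\ - m%:Z <= a, a + 1 <= m%:Z &
    a%:~R * x <= m%:R * y <= (a%:~R + 1) * x].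
Proof.
move=> m0 yx; have mr : 1 <= m%:R :> R by rewrite ler1n.
have [x0|x0] := eqVneq x 0.
  exists 0; split; try lia.
  have y0 : y = 0 by apply/eqP; rewrite -normr_eq0; have := normr_ge0 y; lra.
  by rewrite x0 y0 !mulr0 lexx.
have xp : 0 < x by rewrite lt_neqAle eq_sym x0 (le_trans _ yx).
have [y1 y2] : - x <= y /\ y <= x by move: yx; rewrite ler_norml => /andP.
have /andP[] := floor_itv (m%:R * y / x); set a := Num.floor _.
rewrite intrD ler_pdivlMr // ltr_pdivrMr // => a1 a2.
have lea : - m%:Z <= a.
  rewrite floor_ge_int ler_pdivlMr // intrN -pmulrn mulNr -mulrN.
  by rewrite ler_wpM2l //; lra.
(* The floor reaches [m] only when [y = x]; the top interval, starting at [m - 1], then serves. *)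
have [am|am] := lerP (a + 1) m%:Z; first by exists a; split; rewrite // a1 ltW.
have am' : m%:R <= a%:~R :> R by rewrite pmulrn ler_int; lia.
exists (m%:Z - 1); split; [lia|lia|].
rewrite intrB -pmulrn subrK; apply/andP; split; last by rewrite ler_wpM2l //; lra.
have : m%:R * x <= a%:~R * x by rewrite ler_pM2r.
lra.
Qed.

Lemma leq_side s t : (s <= t)%N -> (side s <= side t)%N.
Proof.
move=> /subnK <-; elim: (t - s)%N => [//|k IH].
by apply: leq_trans IH _; rewrite addSn sideS leq_pmull // addn_gt0 orbT.
Qed.

(** The vector is split along the adjacent slopes [a / m] and [(a + 1) / m], whose scales lie
    between [2 * m ^ 2] and [2 * m ^ 2 + 4 * m + 1]; splitting and travelling each lose a fraction
    O(1/m^2). *)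
Lemma near_cone (b : bool) (m : nat) (P : R * R) (x y : R) :
  (0 < m)%N -> `|y| <= x ->
  let d := Num.sqrt (x ^+ 2 + y ^+ 2) in
  let v := swap_if b (x, y) in
  near P (P.1 + v.1, P.2 + v.2)
    (d + 31 * d / (m ^ 2)%:R + 20 * (side (2 * m ^ 2 + 4 * m + 1))%:R).
Proof.
move=> m0 yx d v; have [a [la ua /andP[l1 l2]]] := slope_bracket m0 yx.
have mr : 1 <= m%:R :> R by rewrite ler1n.
have [[|t1] [od1 sl1 p1] /andP[t1l t1u]] :=
  @slope_code R m a b m0 ltac:(lia); first by [].
have [[|t2] [od2 sl2 p2] /andP[t2l t2u]] :=
  @slope_code R m (a + 1) b m0 ltac:(lia); first by [].
pose x1 := (a%:~R + 1) * x - m%:R * y; pose x2 := m%:R * y - a%:~R * x.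
have x10 : 0 <= x1 by rewrite /x1; lra.
have x20 : 0 <= x2 by rewrite /x2; lra.
have xE : x1 + x2 = x by rewrite /x1 /x2; ring.
have yE : x1 * (a%:~R / m%:R) + x2 * ((a + 1)%:~R / m%:R) = y.
  by rewrite /x1 /x2 intrD; field; apply/eqP; lra.
have h1 := near_travel t1 P x10; have h2 := near_travel t2 _ x20.
move: (near_trans h1 (h2 _)) => {h1 h2}; rewrite od1 od2 sl1 sl2.
set v1 := swap_if b (x1, _); set v2 := swap_if b (x2, _) => h.
have -> : (P.1 + v.1, P.2 + v.2) = (P.1 + v1.1 + v2.1, P.2 + v1.2 + v2.2).
  rewrite -!addrA; have [-> ->] : v.1 = v1.1 + v2.1 /\ v.2 = v1.2 + v2.2 => //.
  rewrite /v /v1 /v2; case: (b) => /=; rewrite xE; split=> //.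
    by rewrite -yE; ring.
  by rewrite -yE; ring.
apply: near_le h _.
have := @sqrt_two_slopes x1 x2 (a%:~R / m%:R) ((a + 1)%:~R / m%:R) (m%:R^-1)
  x10 x20 ltac:(by rewrite invr_ge0; lra) ltac:(by rewrite intrD mulrDl mul1r).
rewrite xE yE -/d.
set d1 := x1 * _; set d2 := x2 * _ => hd.
have d10 : 0 <= d1 by rewrite mulr_ge0 ?sqrtr_ge0.
have d20 : 0 <= d2 by rewrite mulr_ge0 ?sqrtr_ge0.
have x0 : 0 <= x by rewrite -xE addr_ge0.
have xd : x <= d.
  by rewrite -[x]ger0_norm // -sqrtr_sqr ler_sqrt ?lerDl ?sqr_ge0 // addr_ge0 ?sqr_ge0.
pose M : R := (m ^ 2)%:R.
have M1 : 1 <= M by rewrite ler1n expn_gt0 m0.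
have ME : (m%:R^-1) ^+ 2 = M^-1 :> R by rewrite /M natrX exprVn.
have iM0 : 0 < M^-1 by rewrite invr_gt0; lra.
have iM1 : M^-1 <= 1 by rewrite invf_le1; lra.
have hd' : d1 + d2 <= d + d * M^-1 / 2.
  have : x * M^-1 <= d * M^-1 by rewrite ler_pM2r.
  by move: hd; rewrite ME; lra.
have den (t : nat) e : 0 <= e -> (2 * m ^ 2 <= t.+1)%N ->
    30 * e / (t%:R + 8) <= 15 * e * M^-1.
  move=> e0 tm; have : M <= (t%:R + 8) / 2.
    have : (2 * m ^ 2)%:R <= t.+1%:R :> R by rewrite ler_nat.
    by rewrite natrM -[t.+1%:R]natr1 -/M; lra.
  move=> Mt; have -> : 30 * e / (t%:R + 8) = 15 * e * ((t%:R + 8) / 2)^-1.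
    by field; have := ler0n R t; move=> ?; apply/eqP; lra.
  by apply: ler_wpM2l; [lra|rewrite lef_pV2 ?posrE //; lra].
have e1 := den t1 d1 d10 t1l; have e2 := den t2 d2 d20 t2l.
have Lb t : (t.+1 <= 2 * m ^ 2 + 4 * m + 1)%N ->
    (side t.+1)%:R <= (side (2 * m ^ 2 + 4 * m + 1))%:R :> R.
  by move=> h; rewrite ler_nat leq_side.
have Lb1 := Lb _ t1u; have Lb2 := Lb _ t2u.
have d0 : 0 <= d by exact: sqrtr_ge0.
(* Travelling wastes [15 * (d1 + d2) / M <= 30 * d / M] and splitting at most [d / (2 * M)], whence
   31. *)
have f1 : (d1 + d2) * M^-1 <= 2 * d * M^-1.
  rewrite ler_pM2r //; have : d * M^-1 <= d by rewrite ler_piMr.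
  lra.
have f0 : 0 <= d * M^-1 by rewrite mulr_ge0 // ltW.
rewrite -/M -/d; lra.
Qed.

(** Swapping the axes and exchanging the endpoints bring every vector into the cone of
    [near_cone]. *)
Lemma near_euclid (m : nat) (P Q : R * R) : (0 < m)%N ->
  near P Q (dst P Q + 31 * dst P Q / (m ^ 2)%:R +
    20 * (side (2 * m ^ 2 + 4 * m + 1))%:R).
Proof.
move=> m0; pose b := `|Q.1 - P.1| < `|Q.2 - P.2|.
have key (A B : R * R) : `|(swap_if b (B.1 - A.1, B.2 - A.2)).2| <=
      (swap_if b (B.1 - A.1, B.2 - A.2)).1 ->
    near A B (dst A B + 31 * dst A B / (m ^ 2)%:R +
      20 * (side (2 * m ^ 2 + 4 * m + 1))%:R).
  case: (b) => /= h; [have := near_cone true A m0 h|have := near_cone false A m0 h];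
    rewrite /= ![_ + (_ - _)]addrC !subrK -surjective_pairing [dst A B]dst_sym //.
  by rewrite [X in Num.sqrt X]addrC.
case: (lerP 0 (swap_if b (Q.1 - P.1, Q.2 - P.2)).1) => s0.
  apply: key; rewrite -[leRHS]ger0_norm //; move: s0 => _.
  by rewrite /b; case: ltP => [/ltW|].
apply: near_sym; rewrite dst_sym; apply: key.
rewrite -[leRHS]ger0_norm; last by move: s0; case: (b) => /=; lra.
move: s0 => _; rewrite /b (distrC Q.1) (distrC Q.2).
by case: ltP => /= [/ltW|].
Qed.

Lemma side_le_expn n : (side n <= (n + 8) ^ n.+1)%N.
Proof.
elim: n => [//|n IH]; rewrite sideS [leqRHS]expnS; apply: leq_mul; first lia.
by apply: leq_trans IH _; rewrite leq_exp2r // addSn.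
Qed.

(** Apply [ln u <= u - 1] to the square root [u] of [y]. This crude bound turns n log n into
    n^(3/2). *)
Lemma ln_le_sqrt (y : R) : 0 < y -> ln y <= 2 * Num.sqrt y.
Proof.
move=> y0; have s0 : 0 < Num.sqrt y by rewrite sqrtr_gt0.
rewrite -{1}[y]sqr_sqrtr ?ltW // lnXn // mulr2n.
by have := @le_ln1Dx R (Num.sqrt y - 1) ltac:(lra); rewrite subrKC; lra.
Qed.

(* This estimate is where the exponent 2/3 comes from: log d is about n log n. *)
Lemma ln_pow_le (n : nat) (d : R) : 1 < d -> d <= (side n.+1)%:R ->
  ln d `^ (2 / 3) <= 2 * (n%:R + 9).
Proof.
move=> d1 dL; pose y : R := n%:R + 9.
have y0 : 9 <= y by rewrite /y; have := ler0n R n; lra.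
have ld : 0 <= ln d by rewrite ln_ge0 // ltW.
have dy : ln d <= y * (2 * Num.sqrt y).
  apply: (@le_trans _ _ (ln (y ^+ n.+2))).
    rewrite ler_ln ?posrE ?exprn_gt0; try lra.
    apply: le_trans dL _; rewrite (_ : y = (n.+1 + 8)%N%:R) -?natrX ?ler_nat ?side_le_expn //.
    by rewrite /y natrD -natr1; ring.
  rewrite lnXn ?(lt_le_trans _ y0) // -[_ *+ _]mulr_natl.
  apply: ler_pM; rewrite ?ln_ge0 ?ler0n //; try lra.
    by rewrite /y -!natr1; lra.
  by apply: ln_le_sqrt; lra.
have le : ln d <= (2 * y) `^ (3 / 2).
  have -> : 3 / 2 = 1 + 2^-1 :> R by field.
  rewrite powRD; last by apply/implyP => _; apply/eqP; lra.
  rewrite powRr1 ?powR12_sqrt; try lra.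
  apply: le_trans dy _; have : Num.sqrt y <= Num.sqrt (2 * y) by rewrite ler_sqrt; lra.
  by move=> h; have := ler_wpM2l (_ : 0 <= 2 * y) h; lra.
have := @ge0_ler_powR R (2 / 3) ltac:(lra) _ _ _ _ le.
rewrite -powRrM (_ : 3 / 2 * (2 / 3) = 1) ?powRr1; [|lra|by field].
by apply; rewrite nnegrE ?powR_ge0.
Qed.

End Distance.

(** * Assembly of the upper and lower bounds *)

Theorem corollary3 (R : realType) :
  exists (H : simple_graph (int * int)%type) (K D : R),
    1 < D /\
    forall p q : int * int,
      D <= euclid_dist R p q ->
      exists2 n : nat, is_graph_dist H p q n &
        `|n%:R - euclid_dist R p q|
          <= K * (euclid_dist R p q / ln (euclid_dist R p q) `^ (2 / 3)).
Proof.
(* With [D = side 8] the scale [n] of the distance is at least 8, so that [m] below is positive. *)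
exists (highway_graph R), 5300, (side 8)%:R; split; first by have := side_ge8 R 8; lra.
move=> p q; set d := euclid_dist R p q => dL8.
have dE : d = dst (real_pt R p) (real_pt R q) by rewrite /d /euclid_dist !intrB.
have d8 : 8 <= d by have := side_ge8 R 8; lra.
pose B := [pred k | (side k)%:R <= d].
have ubB k : B k -> (k <= Num.truncn d)%N.
  move=> /= h; rewrite truncn_ge_nat; last lra.
  by apply: le_trans h; rewrite ler_nat; have := side_gt k; lia.
case: (ex_maxnP (ex_intro (fun k => B k) 8%N dL8) ubB) => n Ln maxn.
have n8 : (8 <= n)%N := maxn 8%N dL8.
have dLS : d <= (side n.+1)%:R.
  by rewrite leNgt; apply/negP => /ltW /(maxn n.+1); rewrite ltnn.
(* With [8 * m ^ 2 <= n] the scales used stay at most [n - 1], whose side is at most [d / n];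
   conversely [n <= 32 * m ^ 2]. *)
pose m := PeanoNat.Nat.sqrt (n %/ 8).
have [/ssrnat.leP m1 /ssrnat.ltP m2] := PeanoNat.Nat.sqrt_specif (n %/ 8)%N.
rewrite -/m multE in m1; rewrite -/m multE mulSn mulnS in m2.
have m0 : (0 < m)%N by case: (m) m2 => //; lia.
have mm : (m <= m * m)%N by rewrite leq_pmulr.
have n8r : 8 <= n%:R :> R by rewrite (ler_nat R 8).
have dn : 1 <= d / n%:R.
  rewrite ler_pdivlMr ?mul1r; last lra.
  by apply: le_trans Ln; rewrite ler_nat ltnW // (leq_ltn_trans _ (side_gt n)) // leq_addr.
have up : reach p q (d + 1060 * (d / n%:R)).
  have hp := reach_base R p; have hq := reach_sym (reach_base R q).
  have vn v : near (vertex_pos R v) (real_pt R v) 20.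
    have [v1 v2] := vertex_pos_near R v.
    by apply: near_le (near_l1 _ _) _ => /=; lra.
  have h := reach_trans hp (reach_trans (vn p) (reach_trans
    (near_euclid (real_pt R p) (real_pt R q) m0) (reach_trans (near_sym (vn q)) hq))).
  (* [1060 = 31 * 32 + 20 + 48], where 48 is the cost 4 + 20 + 20 + 4 at the two ends and
     [1 <= d / n]. *)
  apply: reach_le h _; rewrite -dE.
  have LL : (side (2 * m ^ 2 + 4 * m + 1))%:R <= d / n%:R.
    rewrite ler_pdivlMr; last lra.
    apply: le_trans Ln; rewrite -natrM ler_nat.
    have nE : n = n.-1.+1 by lia.
    rewrite {2}nE sideS mulnC leq_mul //; first lia.
    by apply: leq_side; rewrite -mulnn; lia.
  have dm : d / (m ^ 2)%:R <= 32 * (d / n%:R).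
    have : n%:R <= 32 * (m ^ 2)%:R :> R.
      by rewrite -natrM ler_nat -mulnn; lia.
    have : 1 <= (m ^ 2)%:R :> R by rewrite ler1n expn_gt0 m0.
    move: (m ^ 2)%:R => M M1 nM.
    rewrite mulrCA ler_pM2l; last lra.
    by rewrite ler_pdivlMr ?[_ * n%:R]mulrC ?ler_pdivrMr; lra.
  by rewrite -mulrA; lra.
have low s : path (highway_graph R) p s -> last p s = q -> d - 32 <= (size s)%:R.
  move=> /path_dst h lq; rewrite lq in h.
  have vn v : dst (real_pt R v) (vertex_pos R v) <= 16.
    have [v1 v2] := vertex_pos_near R v.
    by rewrite dst_sym; apply: le_trans (dst_le_l1 _ _) _ => /=; lra.
  have := dst_triangle (vertex_pos R p) (real_pt R p) (real_pt R q).
  have := dst_triangle (vertex_pos R q) (vertex_pos R p) (real_pt R q).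
  have := vn p; have := vn q; rewrite [dst (real_pt R q) _]dst_sym -dE; lra.
pose G := [pred k | `[< exists2 s, graph_path (highway_graph R) p q s & size s = k >]].
have [s [ps ls ss]] := up.
(* The walk is shortened to a simple path, so a least length exists. *)
case: (shortenP ps) ls ss => s' ps' us' subs ls ss.
have Gs : G (size s') by apply/asboolP; exists s'.
case: (ex_minnP (ex_intro (fun k => G k) _ Gs)) => N /asboolP[s0 [ps0 us0 ls0] sN] minN.
exists N.
  split; first by exists s0.
  by move=> s1 gs1; apply: minN; apply/asboolP; exists s1.
have Nlow : d - 32 <= N%:R by rewrite -sN; exact: low.
have Nup : N%:R <= d + 1060 * (d / n%:R).
  apply: le_trans (_ : (size s')%:R <= _); first by rewrite ler_nat minN.
  apply: le_trans ss; rewrite ler_nat; case/andP: (us') => _ us; exact: uniq_leq_size us subs.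
apply: (@le_trans _ _ (1060 * (d / n%:R))).
  by rewrite ler_norml; apply/andP; split; lra.
(* The factor 5 comes from [2 * (n + 9) <= 5 * n], valid as [n >= 8]. *)
have -> : 5300 = 1060 * 5 :> R by ring.
rewrite -mulrA ler_pM2l //.
have ln0 : 0 < ln d by rewrite ln_gt0; lra.
have lp0 : 0 < ln d `^ (2 / 3) by rewrite powR_gt0.
have := @ln_pow_le R n d ltac:(lra) dLS => lnb.
rewrite mulrCA ler_pM2l; last lra.
rewrite ler_pdivlMr // mulrC ler_pdivrMr; lra.
Qed.
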